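(* Let $\Gamma=(V,c)$ be a DC network with Laplacian $\mathcal{L}_c$, let $0<|u|_{\min}\le |u|_{\max}$ be positive real numbers, let $m\ge 1$ be an integer, and let $\bm u=(u_1,\dots,u_m)$ and $\bm s=(s_1,\dots,s_m)$ be elements of $\mathcal{C}(V,\mathbb{R}^m)$ such that $|u|_{\min}\le |u_j(x)|\le |u|_{\max}$ for all $j=1,\dots,m$ and all $x\in V$. Let $\epsilon>0$. If $\Gamma'$ is a DC network that is an $\epsilon$-approximation of $\Gamma$, then $$\mathrm{rms}(\Gamma',\bm u,\bm s)\;\le\;\mathrm{rms}(\Gamma,\bm u,\bm s)+\epsilon\,\frac{\|\mathcal{Q}_{\Gamma,\bm u}\|_2\cdot\|\mathbf{1}_m-\phi_{\bm u}\|}{\sqrt{m|V|}}.$$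
   Context: Let $V$ be a finite nonempty set. $\mathcal{C}(V,\mathbb{R}^m)$ is the space of functions $V\to\mathbb{R}^m$, with components written $\bm u=(u_1,\dots,u_m)$, $u_j\in\mathcal{C}(V)=\mathcal{C}(V,\mathbb{R})$. For $u\in\mathcal{C}(V)$ write $\int_V u\,dx=\sum_{x\in V}u(x)$. Products of functions in $\mathcal{C}(V)$ are pointwise. The inner product on $\mathcal{C}(V,\mathbb{R}^m)$ is $\langle\bm u,\bm v\rangle=\sum_{j=1}^m\int_V u_jv_j\,dx$, with associated norm $\|\cdot\|$ (also written $\|\cdot\|_2$); for a linear operator, $\|\cdot\|_2$ is the induced operator (spectral) norm. A DC network is a pair $\Gamma=(V,c)$ where $c:V\times V\to[0,\infty)$ (the conductance) is symmetric and $c(x,x)=0$ for all $x\in V$. Its Laplacian is the linear operator on $\mathcal{C}(V)$ given by $\mathcal{L}_c(u)(x)=\sum_{y\in V}c(x,y)(u(x)-u(y))$. Its energy is $\mathcal{E}(u,v)=\int_V u\,\mathcal{L}_c(v)\,dx$ for $u,v\in\mathcal{C}(V)$. For $\epsilon>0$, a DC network $\Gamma'=(V,c')$ (on the same vertex set) with energy $\mathcal{E}'$ is an $\epsilon$-approximation of a DC network $\Gamma=(V,c)$ with energy $\mathcal{E}$ if for all $u\in\mathcal{C}(V)$: $\frac{1}{1+\epsilon}\mathcal{E}(u,u)\le\mathcal{E}'(u,u)\le(1+\epsilon)\mathcal{E}(u,u)$. The error of a DC network $\Gamma=(V,c)$ in the data pair $(\bm u,\bm s)$ is $$\mathrm{rms}(\Gamma,\bm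 u,\bm s)=\sqrt{\frac{1}{m|V|}\sum_{j=1}^m\int_V\left(u_j\mathcal{L}_c(u_j)-s_j\right)^2dx}.$$ $\mathcal{Q}_{\Gamma,\bm u}$ is the linear operator on $\mathcal{C}(V,\mathbb{R}^m)$ defined by $\mathcal{Q}_{\Gamma,\bm u}(v_1,\dots,v_m)=\left(u_1\mathcal{L}_c(u_1v_1),\dots,u_m\mathcal{L}_c(u_mv_m)\right)$. $\mathbf{1}_m\in\mathcal{C}(V,\mathbb{R}^m)$ is the function all of whose components are identically $1$ on $V$. With $u_j^{-1}(x)=1/u_j(x)$, $$\phi_{\bm u}=\left(\frac{\int_V u_1^{-1}dx}{\|u_1^{-1}\|^2}\,u_1^{-1},\dots,\frac{\int_V u_m^{-1}dx}{\|u_m^{-1}\|^2}\,u_m^{-1}\right)\in\mathcal{C}(V,\mathbb{R}^m).$$ *)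

(* Defs.v *)
From HB Require Import structures.
From mathcomp Require Import all_boot all_order all_algebra.
From mathcomp Require Import all_classical all_reals.
From mathcomp Require Import ring.

Set Implicit Arguments.
Unset Strict Implicit.
Unset Printing Implicit Defensive.

Import Order.TTheory GRing.Theory Num.Theory.

Local Open Scope classical_set_scope.
Local Open Scope ring_scope.

Record dc_network (R : realType) (V : finType) := DCNetwork {
  conductance :> V -> V -> R ;
  conductance_ge0 : forall x y, 0 <= conductance x y ;
  conductance_sym : forall x y, conductance x y = conductance y x ;
  conductance_diag : forall x, conductance x x = 0 }.

Section Scalar.
Context {R : realType} {V : finType}.
Implicit Types (G : dc_network R V) (u v : V -> R).

Definition vint u : R := \sum_(x : V) u x.

Definition laplacian G u : V -> R := fun x => \sum_(y : V) G x y * (u x - u y).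

Definition energy G u v : R := vint (fun x => u x * laplacian G v x).

Definition eps_approximation (eps : R) (G' G : dc_network R V) : Prop :=
  forall u : V -> R,
    (1 + eps)^-1 * energy G u u <= energy G' u u <= (1 + eps) * energy G u u.

Definition scalar_norm u : R := Num.sqrt (vint (fun x => u x * u x)).

End Scalar.

(* An element of C(V, R^m) is a function [V -> 'rV[R]_m], with the pointwise
   vector space structure; [component u j] is its component u_j. *)
Section Vectorial.
Context {R : realType} {V : finType} {m : nat}.
Implicit Types (G : dc_network R V) (u v s : V -> 'rV[R]_m).

Definition component u (j : 'I_m) : V -> R := fun x => u x 0 j.

Definition of_comps (f : 'I_m -> V -> R) : V -> 'rV[R]_m :=
  fun x => \row_(j < m) f j x.

Definition inner u v : R :=
  \sum_(j < m) vint (fun x => component u j x * component v j x).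

Definition norm2 u : R := Num.sqrt (inner u u).

(* [sup] is meaningful here: the image of the unit ball is nonempty, and it is
   bounded above since [T] is linear on a finite-dimensional space. *)
Definition opnorm2 (T : {linear (V -> 'rV[R]_m) -> (V -> 'rV[R]_m)}) : R :=
  sup [set norm2 (T v) | v in [set v | norm2 v <= 1]].

Definition rms G u s : R :=
  Num.sqrt ((m%:R * #|V|%:R)^-1 *
    \sum_(j < m) vint (fun x =>
      (component u j x * laplacian G (component u j) x - component s j x) ^+ 2)).

Definition Qop G u v : V -> 'rV[R]_m :=
  of_comps (fun j x =>
    component u j x * laplacian G (fun y => component u j y * component v j y) x).

Lemma Qop_linear G u : linear (Qop G u).
Proof.
move=> a v w; apply/funext => x; apply/rowP => j.
rewrite /Qop /of_comps /component /laplacian /= !mxE.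
rewrite mulrCA -mulrDr; congr (_ * _); rewrite mulr_sumr -big_split /=.
apply: eq_bigr => y _.
have E z : (a *: v + w) z 0 j = a * v z 0 j + w z 0 j.
  by rewrite -[LHS]/((a *: v z + w z) 0 j) !mxE.
by rewrite !E; ring.
Qed.

HB.instance Definition _ G u :=
  GRing.isLinear.Build R (V -> 'rV[R]_m) (V -> 'rV[R]_m) *:%R (Qop G u)
    (Qop_linear G u).

Definition inv_comp u (j : 'I_m) : V -> R := fun x => (component u j x)^-1.

Definition phi u : V -> 'rV[R]_m :=
  of_comps (fun j x =>
    vint (inv_comp u j) / scalar_norm (inv_comp u j) ^+ 2 * inv_comp u j x).

Definition ones : V -> 'rV[R]_m := of_comps (fun _ _ => 1).

End Vectorial.

(* Main.v *)
(** The operator [D = Q_{G'} - Q_G] is self-adjoint, kills [phi u], and the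
    approximation hypothesis says that [|<D v, v>| <= eps <Q_G v, v>], which is
    at most [eps ||Q_G|| ||v||^2].  By polarization this bounds the norm of [D]
    by [eps ||Q_G||], so [||D 1|| = ||D (1 - phi u)||] is at most
    [eps ||Q_G|| ||1 - phi u||]; the triangle inequality concludes, since
    [rms G u s] is [||Q_G 1 - s||] up to normalization. *)
Require Import Defs.
From HB Require Import structures.
From mathcomp Require Import all_boot all_order all_algebra.
From mathcomp Require Import all_classical all_reals.
From mathcomp Require Import ring lra.

Set Implicit Arguments.
Unset Strict Implicit.
Unset Printing Implicit Defensive.

Import Order.TTheory GRing.Theory Num.Theory.

Local Open Scope ring_scope.

(** * Energies of scalar functions *)

Section Scalar.
Context {R : realType} {V : finType}.
Implicit Types (G : dc_network R V) (a b : V -> R).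

(** The energy splits into a diagonal sum, symmetric by commutativity, and a cross sum, symmetric by
    exchanging the two summations and using the symmetry of the conductance. *)
Lemma energyC G a b : energy G a b = energy G b a.
Proof.
have E f g : energy G f g =
    \sum_x \sum_y G x y * (f x * g x) - \sum_x \sum_y G x y * (f x * g y).
  rewrite -sumrB; apply: eq_bigr => x _.
  rewrite mulr_sumr -sumrB; apply: eq_bigr => y _; ring.
rewrite !E; congr (_ - _).
  by apply: eq_bigr => x _; apply: eq_bigr => y _; rewrite (mulrC (a x)).
rewrite exchange_big; apply: eq_bigr => x _; apply: eq_bigr => y _.
by rewrite conductance_sym (mulrC (a y)).
Qed.

Lemma eps_approximation_le (eps : R) G' G a : 0 < eps ->
  eps_approximation eps G' G ->
  `|energy G' a a - energy G a a| <= eps * energy G a a.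
Proof.
move=> e0 /(_ a)/andP[].
set E := energy G a a; set E' := energy G' a a => lo hi.
have e1 : 0 < 1 + eps by lra.
have lo' : E <= (1 + eps) * E'.
  by rewrite mulrC -ler_pdivrMr // mulrC.
(* The two bounds together give [E <= (1 + eps) ^+ 2 * E], which forces the sign of [E]. *)
have E0 : 0 <= E by nra.
by rewrite ler_norml; apply/andP; split; nra.
Qed.

End Scalar.

(** * Euclidean geometry of vector-valued functions *)

Section Inner.
Context {R : realType} {V : finType} {m : nat}.
Implicit Types (v w z : V -> 'rV[R]_m) (a : R).

Lemma componentD v w j x :
  component (v + w) j x = component v j x + component w j x.
Proof. by rewrite -[LHS]/((v x + w x) 0 j) mxE. Qed.

Lemma componentZ a v j x : component (a *: v) j x = a * component v j x.
Proof. by rewrite -[LHS]/((a *: v x) 0 j) mxE. Qed.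

Lemma component_of_comps (f : 'I_m -> V -> R) j :
  component (of_comps f) j = f j.
Proof. by apply/funext => x; rewrite /component /of_comps mxE. Qed.

Lemma innerC v w : inner v w = inner w v.
Proof. by apply: eq_bigr => j _; apply: eq_bigr => x _; rewrite mulrC. Qed.

Lemma innerDl v w z : inner (v + w) z = inner v z + inner w z.
Proof.
rewrite -big_split; apply: eq_bigr => j _; rewrite -big_split.
by apply: eq_bigr => x _; rewrite componentD mulrDl.
Qed.

Lemma innerZl a v z : inner (a *: v) z = a * inner v z.
Proof.
rewrite mulr_sumr; apply: eq_bigr => j _; rewrite mulr_sumr.
by apply: eq_bigr => x _; rewrite componentZ mulrA.
Qed.

Lemma innerNl v z : inner (- v) z = - inner v z.
Proof. by rewrite -scaleN1r innerZl mulN1r. Qed.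

Lemma innerDr v w z : inner z (v + w) = inner z v + inner z w.
Proof. by rewrite innerC innerDl !(innerC z). Qed.

Lemma innerZr a v z : inner z (a *: v) = a * inner z v.
Proof. by rewrite innerC innerZl innerC. Qed.

Lemma innerNr v z : inner z (- v) = - inner z v.
Proof. by rewrite innerC innerNl innerC. Qed.

Lemma inner_ge0 v : 0 <= inner v v.
Proof.
by apply: sumr_ge0 => j _; apply: sumr_ge0 => x _; rewrite -expr2 sqr_ge0.
Qed.

Lemma norm2_ge0 v : 0 <= norm2 v.
Proof. exact: sqrtr_ge0. Qed.

Lemma sqr_norm2 v : norm2 v ^+ 2 = inner v v.
Proof. by rewrite sqr_sqrtr // inner_ge0. Qed.

Lemma component_le_norm2 v j x : `|component v j x| <= norm2 v.
Proof.
rewrite -sqrtr_sqr ler_sqrt ?inner_ge0 // /inner (bigD1 j) //= {1}/vint.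
rewrite (bigD1 x) //= -expr2 -addrA lerDl addr_ge0 //.
  by apply: sumr_ge0 => y _; rewrite -expr2 sqr_ge0.
by apply: sumr_ge0 => k _; apply: sumr_ge0 => y _; rewrite -expr2 sqr_ge0.
Qed.

Lemma le_norm2 v w : (forall j x, `|component v j x| <= component w j x) ->
  norm2 v <= norm2 w.
Proof.
move=> vw; rewrite ler_sqrt ?inner_ge0 //.
apply: ler_sum => j _; apply: ler_sum => x _.
rewrite -!expr2 -(real_normK (num_real (component v j x))).
by rewrite lerXn2r ?nnegrE // (le_trans _ (vw j x)).
Qed.

Lemma norm2_eq0 v : norm2 v = 0 -> v = 0.
Proof.
move=> v0; apply/funext => x; apply/rowP => j.
have := component_le_norm2 v j x.
by rewrite v0 normr_le0 => /eqP; rewrite /component => ->; rewrite mxE.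
Qed.

Lemma norm2Z a v : norm2 (a *: v) = `|a| * norm2 v.
Proof.
by rewrite /norm2 innerZl innerZr mulrA -expr2 sqrtrM ?sqr_ge0 // sqrtr_sqr.
Qed.

Lemma norm2_0 : norm2 (0 : V -> 'rV[R]_m) = 0.
Proof. by rewrite -(scale0r 0) norm2Z normr0 mul0r. Qed.

(** Cauchy-Schwarz: expand the square norm of [norm2 w *: v - norm2 v *: w] and divide by
    [norm2 v * norm2 w], the zero cases being treated apart. *)
Lemma inner_le_norm2 v w : inner v w <= norm2 v * norm2 w.
Proof.
have [/norm2_eq0 ->|v0] := eqVneq (norm2 v) 0.
  by rewrite norm2_0 -(scale0r 0) innerZl !mul0r.
have [/norm2_eq0 ->|w0] := eqVneq (norm2 w) 0.
  by rewrite norm2_0 -(scale0r 0) innerZr mul0r mulr0.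
have p : 0 < norm2 v * norm2 w by rewrite mulr_gt0 // lt0r ?v0 ?w0 norm2_ge0.
have := inner_ge0 (norm2 w *: v - norm2 v *: w).
rewrite !(innerDl, innerDr, innerNl, innerNr, innerZl, innerZr) (innerC w v).
rewrite -!sqr_norm2 => H; rewrite -(ler_pM2l p).
by move: H; set i := inner v w; nra.
Qed.

Lemma ler_norm2D v w : norm2 (v + w) <= norm2 v + norm2 w.
Proof.
rewrite -ler_sqr ?nnegrE ?addr_ge0 ?norm2_ge0 //.
rewrite sqr_norm2 innerDl !innerDr (innerC w v) -!sqr_norm2.
by have := inner_le_norm2 v w; nra.
Qed.

(** For a self-adjoint operator, polarization recovers [inner (D x) y] from the quadratic form at
    [x + y] and [x - y], and the parallelogram law sums the two bounds. *)
Lemma selfadjoint_norm2_le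
    (D : {linear (V -> 'rV[R]_m) -> (V -> 'rV[R]_m)}) a v :
  (forall w z, inner (D w) z = inner w (D z)) ->
  (forall w, `|inner (D w) w| <= a * norm2 w ^+ 2) ->
  norm2 (D v) <= a * norm2 v.
Proof.
move=> Dsym Dle.
have [/norm2_eq0 ->|v0] := eqVneq (norm2 v) 0.
  by rewrite linear0 norm2_0 mulr0.
have [Dv0|Dv0] := eqVneq (norm2 (D v)) 0.
  (* The sign of [a] is not assumed; nonnegativity of the right-hand side comes from the bound at
     [v]. *)
  have := le_trans (normr_ge0 _) (Dle v).
  by rewrite Dv0 expr2 mulrA pmulr_lge0 // lt0r v0 norm2_ge0.
have p : 0 < norm2 v by rewrite lt0r v0 norm2_ge0.
have q : 0 < norm2 (D v) by rewrite lt0r Dv0 norm2_ge0.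
(* Polarization, with [v] and [D v] rescaled to have the same norm. *)
pose x := norm2 (D v) *: v; pose y := norm2 v *: D v.
have /ler_normlP[_ plus] := Dle (x + y).
have /ler_normlP[minus _] := Dle (x - y).
move: plus minus; rewrite !sqr_norm2 !(linearD, linearN).
rewrite !(innerDl, innerDr, innerNl, innerNr) (Dsym y x) (innerC y (D x)).
have -> : inner (D x) y = norm2 (D v) ^+ 3 * norm2 v.
  by rewrite linearZ /= innerZl innerZr -sqr_norm2; ring.
have -> : inner x x = (norm2 v * norm2 (D v)) ^+ 2.
  by rewrite innerZl innerZr -sqr_norm2; ring.
have -> : inner y y = (norm2 v * norm2 (D v)) ^+ 2.
  by rewrite innerZl innerZr -sqr_norm2; ring.
move=> plus minus.
(* Adding [plus] and [minus] leaves [norm2 (D v) ^+ 3 * norm2 v <= a * (norm2 v * norm2 (D v)) ^+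
   2]; the positive factor in [r] is then cancelled. *)
have r : 0 < norm2 (D v) ^+ 2 * norm2 v by rewrite mulr_gt0 ?exprn_gt0.
by rewrite -(ler_pM2l r); nra.
Qed.

End Inner.

(** * The operators [Qop G u] and the error *)

Section Operator.
Context {R : realType} {V : finType} {m : nat}.
Implicit Types (G : dc_network R V) (u v w s : V -> 'rV[R]_m).

(** Multiplication by [component u j] moves across the inner product, so facts about the energy
    transfer to [Qop G u]. *)
Lemma inner_Qop G u v w : inner (Qop G u v) w =
  \sum_(j < m) energy G (fun x => component u j x * component w j x)
                        (fun x => component u j x * component v j x).
Proof.
apply: eq_bigr => j _; apply: eq_bigr => x _.
by rewrite component_of_comps; ring.
Qed.

Lemma Qop_selfadjoint G u v w : inner (Qop G u v) w = inner v (Qop G u w).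
Proof.
rewrite (innerC v) !inner_Qop; apply: eq_bigr => j _; exact: energyC.
Qed.

(** Needed for the supremum in [opnorm2] to be an upper bound. On the unit ball every entry of [v]
    is at most 1 in absolute value, so the triangle inequality gives the bound [b], independent of
    [v]. *)
Lemma Qop_bounded G u :
  exists M, forall v, norm2 v <= 1 -> norm2 (Qop G u v) <= M.
Proof.
pose b j x := `|component u j x| *
  \sum_y G x y * (`|component u j x| + `|component u j y|).
exists (norm2 (of_comps b)) => v v1; apply: le_norm2 => j x.
have uv z : `|component u j z * component v j z| <= `|component u j z|.
  by rewrite normrM ler_piMr // (le_trans (component_le_norm2 _ _ _)).
rewrite !component_of_comps normrM ler_wpM2l //.
apply: (le_trans (ler_norm_sum _ _ _)); apply: ler_sum => y _.
rewrite normrM ger0_norm ?conductance_ge0 // ler_wpM2l ?conductance_ge0 //.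
by apply: (le_trans (ler_normB _ _)); rewrite lerD.
Qed.

Lemma Qop_le_opnorm2 G u v :
  norm2 (Qop G u v) <= opnorm2 (Qop G u) * norm2 v.
Proof.
have [/norm2_eq0 ->|v0] := eqVneq (norm2 v) 0.
  by rewrite linear0 norm2_0 mulr0.
have p : 0 < norm2 v by rewrite lt0r v0 norm2_ge0.
rewrite -ler_pdivrMr // mulrC -[X in X * _]ger0_norm ?invr_ge0 ?norm2_ge0 //.
rewrite -norm2Z -linearZ; apply: ub_le_sup; last first.
  exists ((norm2 v)^-1 *: v) => //=.
  by rewrite norm2Z ger0_norm ?invr_ge0 ?norm2_ge0 // mulVf.
by have [M HM] := Qop_bounded G u; exists M => _ [w /= w1 <-]; exact: HM.
Qed.

(** Each product of [component u j] with the matching component of [phi u] is a constant function,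
    and Laplacians vanish on constants. *)
Lemma Qop_phi G u : (forall j x, component u j x != 0) -> Qop G u (phi u) = 0.
Proof.
move=> u0; apply/funext => x; apply/rowP => j; rewrite !mxE.
rewrite /laplacian big1 ?mulr0 // => y _; rewrite component_of_comps /inv_comp.
by rewrite !(mulrCA (component u j _)) !mulfV // subrr mulr0.
Qed.

Lemma rmsE G u s :
  rms G u s = norm2 (Qop G u ones - s) / Num.sqrt (m%:R * #|V|%:R).
Proof.
have N0 : 0 <= m%:R * #|V|%:R :> R by rewrite mulr_ge0.
rewrite /rms [LHS]sqrtrM ?invr_ge0 // mulrC sqrtrV //.
congr (Num.sqrt _ / _); apply: eq_bigr => j _; apply: eq_bigr => x _.
rewrite componentD component_of_comps -expr2.
have -> : component (- s) j x = - component s j x.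
  by rewrite -scaleN1r componentZ mulN1r.
congr ((_ * laplacian G _ x - _) ^+ 2); apply/funext => y.
by rewrite component_of_comps mulr1.
Qed.

Lemma Qop_approximation_le (eps : R) G G' u v : 0 < eps ->
  eps_approximation eps G' G ->
  norm2 (Qop G' u v - Qop G u v) <= eps * opnorm2 (Qop G u) * norm2 v.
Proof.
move=> e0 hG'.
apply: (selfadjoint_norm2_le (D := (Qop G' u \- Qop G u))) => [w z|w] /=.
  by rewrite innerDl innerDr innerNl innerNr !Qop_selfadjoint.
rewrite innerDl innerNl.
(* The scalar estimate is applied to the product of [component u j] and [component w j], then summed
   over [j]; Cauchy-Schwarz and the operator norm bound the result. *)
apply: (@le_trans _ _ (eps * inner (Qop G u w) w)).
  rewrite !inner_Qop -sumrB mulr_sumr (le_trans (ler_norm_sum _ _ _)) //.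
  by apply: ler_sum => j _; exact: eps_approximation_le.
rewrite -mulrA ler_wpM2l ?(ltW e0) // (le_trans (inner_le_norm2 _ _)) //.
by rewrite expr2 mulrA ler_wpM2r ?norm2_ge0 // Qop_le_opnorm2.
Qed.

End Operator.

Theorem theorem5p1 (R : realType) (V : finType) (hV : (0 < #|V|)%N)
    (G : dc_network R V) (umin umax : R) (humin : 0 < umin)
    (huminmax : umin <= umax) (m : nat) (hm : (1 <= m)%N)
    (u s : V -> 'rV[R]_m)
    (hu : forall (j : 'I_m) (x : V), umin <= `|component u j x| <= umax)
    (eps : R) (heps : 0 < eps) (G' : dc_network R V)
    (hG' : eps_approximation eps G' G) :
  rms G' u s <= rms G u s
    + eps * (opnorm2 (Qop G u) * norm2 (ones - phi u)
             / Num.sqrt (m%:R * #|V|%:R)).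
Proof.
have u0 j x : component u j x != 0.
  by rewrite -normr_gt0 (lt_le_trans humin) //; case/andP: (hu j x).
rewrite !rmsE !mulrA -mulrDl ler_wpM2r ?invr_ge0 ?sqrtr_ge0 //.
(* Both operators kill [phi u], so the correction term can be evaluated at [ones - phi u] instead of
   [ones]. *)
have -> : Qop G' u ones - s =
    (Qop G u ones - s) + (Qop G' u (ones - phi u) - Qop G u (ones - phi u)).
  rewrite (linearB (Qop G u)) (linearB (Qop G' u)) /= !Qop_phi // !subr0.
  by rewrite [RHS]addrC addrA subrK.
apply: (le_trans (ler_norm2D _ _)); rewrite lerD2l.
exact: Qop_approximation_le.
Qed.
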